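(* Consider a finite MDP $\langle\mathcal S,\mathcal A,(\mathcal A(s),s\in\mathcal S),P,r\rangle$, a horizon $T\ge1$ and $\alpha\in(0,1]$. (a) The optimal value function $\mathrm{VaR}^*(s_0):=\sup_{u\in\mathcal U^{\rm RH}}\mathrm{VaR}^u(s_0)$ of the finite-horizon VaR maximization MDP is given by $$\mathrm{VaR}^*(s_0)=\min_{\lambda_0\in\Lambda_0}\Big\{\lambda_0:\ \min_{\tilde u\in\tilde{\mathcal U}^{\rm DM}}V_0^{\tilde u}(s_0,\lambda_0)\ge\alpha\Big\},\qquad s_0\in\mathcal S.$$ (b) For $s_0\in\mathcal S$ let $\mathrm{VaR}^*_-(s_0,\Lambda_0)$ be the left predecessor of $\mathrm{VaR}^*(s_0)$ in $\Lambda_0$, and suppose $\tilde u^*=(\tilde u^*_0,\dots,\tilde u^*_{T-1})\in\tilde{\mathcal U}^{\rm DM}$ is an optimal deterministic Markov policy of the augmented minimization MDP, i.e. $V_0^{\tilde u^*}(s_0,\lambda_0)=\inf_{\tilde u\in\tilde{\mathcal U}^{\rm RH}}V_0^{\tilde u}(s_0,\lambda_0)$ for all $(s_0,\lambda_0)\in\mathcal S\times\mathbb R$. Then the deterministic history-dependent policy $u^*=(u_0^*,\dots,u_{T-1}^* )\in\mathcal U^{\rm DH}$ given by $$u_t^*(s_0,a_0,\dots,s_t)=\tilde u_t^*\Big(s_t,\ \mathrm{VaR}^*_-(s_0,\Lambda_0)-\sum_{\tau=0}^{t-1}r(s_\tau,a_\tau)\Big),\qquad t=0,\dots,T-1,$$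 is optimal for the finite-horizon VaR maximization MDP, i.e. $\mathrm{VaR}^{u^*}(s_0)=\mathrm{VaR}^*(s_0)$ for all $s_0\in\mathcal S$.
   Context: MDP: $\mathcal S$ and $\mathcal A$ are finite sets; $\mathcal A(s)\subseteq\mathcal A$ is the nonempty set of admissible actions in $s$, with $\cup_s\mathcal A(s)=\mathcal A$; $\mathcal K:=\{(s,a):s\in\mathcal S,a\in\mathcal A(s)\}$; $P(\cdot|s,a)$ is a probability distribution on $\mathcal S$ for each $(s,a)\in\mathcal K$; $r:\mathcal K\to\mathbb R$ is the reward function. Policies: $\mathcal U^{\rm RH}$ is the set of randomized history-dependent policies $u=(u_t)_{t}$, where $u_t(\cdot|h_t)$ is a probability distribution on $\mathcal A(s_t)$ for each history $h_t=(s_0,a_0,\dots,s_{t-1},a_{t-1},s_t)\in\mathcal K^t\times\mathcal S$; $\mathcal U^{\rm DH}$ is the subset of deterministic ones ($u_t(h_t)\in\mathcal A(s_t)$). $\mathbb P^u_{s_0}$ is the law of $(s_0,a_0,s_1,a_1,\dots)$ under $u$ started from $s_0$. Finite-horizon quantities: $R_{0:T}:=\sum_{t=0}^{T-1}r(s_t,a_t)$ (the terminal reward is zero); $\Lambda_0:=\{\sum_{t=0}^{T-1}r(s_t,a_t):(s_t,a_t)\in\mathcal K\text{ for all }t\}$; $\mathrm{VaR}^u(s_0):=\inf\{\lambda\in\mathbb R:\mathbb P^u_{s_0}(R_{0:T}\le\lambda)\ge\alpha\}$. Augmented MDP: state space $\tilde{\mathcal S}:=\mathcal S\times\mathbb R$,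 admissible actions $\mathcal A(s)$ in state $(s,\lambda)$; from $(s_t,\lambda_t)$ with action $a_t$ the next state is $(s_{t+1},\lambda_{t+1})$ with $s_{t+1}\sim P(\cdot|s_t,a_t)$ and $\lambda_{t+1}=\lambda_t-r(s_t,a_t)$, $t=0,\dots,T-1$; the only nonzero reward is the terminal reward $\mathbb I\{0\le\lambda_T\}$. $\tilde{\mathcal U}^{\rm RH}$ is the set of randomized policies depending on the history $(s_0,\lambda_0,a_0,\dots,s_t,\lambda_t)$; $\tilde{\mathcal U}^{\rm DM}$ is the set of deterministic Markov policies $\tilde u=(\tilde u_0,\dots,\tilde u_{T-1})$, $\tilde u_t:\mathcal S\times\mathbb R\to\mathcal A$ with $\tilde u_t(s,\lambda)\in\mathcal A(s)$. $V_0^{\tilde u}(s_0,\lambda_0):=\mathbb E^{\tilde u}_{s_0,\lambda_0}[\mathbb I\{0\le\lambda_T\}]=\mathbb P^{\tilde u}_{s_0,\lambda_0}\big(\sum_{t=0}^{T-1}r(s_t,a_t)\le\lambda_0\big)$. Left predecessor of $\lambda\in\mathbb R$ in the finite set $\Lambda_0$: $\max\{y\in\Lambda_0:y<\lambda\}$ if $\lambda>\min\Lambda_0$, and $\lambda-1$ if $\lambda\le\min\Lambda_0$. *)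

(* Defs.v *)
From HB Require Import structures.
From mathcomp Require Import all_boot all_order all_algebra.
From mathcomp Require Import boolp classical_sets reals.
Set Implicit Arguments.
Unset Strict Implicit.
Unset Printing Implicit Defensive.
Import Order.TTheory GRing.Theory Num.Theory.
Local Open Scope classical_set_scope.
Local Open Scope ring_scope.

(* A finitely supported distribution is a list of (weight, outcome) pairs; an
   outcome may be listed several times, in which case its weights add up. This
   also covers distributions on the uncountable state space S * R of the
   augmented process, whose kernel is finitely supported. *)
Definition wlist (R : realType) (X : Type) := seq (R * X).

Definition expect (R : realType) (X : Type) (d : wlist R X) (f : X -> R) : R :=
  \sum_(w <- d) w.1 * f w.2.

Definition prob (R : realType) (X : Type) (d : wlist R X) (E : pred X) : R :=
  expect d (fun x => (E x)%:R).

(* The dynamics of a controlled process, without rewards. *)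
Record dynamics (R : realType) (X : Type) (A : finType) := Dynamics {
  admissible : X -> {set A};
  kernel : X -> A -> wlist R X
}.

(* ([:: (x_0, a_0); ..; (x_(t-1), a_(t-1))], x_t); the time t is the length of
   the list. *)
Definition history (X : Type) (A : finType) := (seq (X * A) * X)%type.

Definition htime (X : Type) (A : finType) (h : history X A) : nat := size h.1.

Definition hstart (X : Type) (A : finType) (h : history X A) : X :=
  if h.1 is p :: _ then p.1 else h.2.

Section Policies.
Variables (R : realType) (X : Type) (A : finType) (D : dynamics R X A).

Definition admissible_pair (p : X * A) : bool := p.2 \in admissible D p.1.

Definition admissible_history (h : history X A) : bool :=
  all admissible_pair h.1.

(* u h a is the probability of taking action a after history h. *)
Definition rpolicy := history X A -> A -> R.
Definition dpolicy := history X A -> A.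
Definition mpolicy := nat -> X -> A.

(* A policy for horizon T is only constrained on admissible histories at the
   decision epochs 0, .., T - 1; its other values are never used. *)
Definition RH (T : nat) : set rpolicy := [set u | forall h : history X A,
  admissible_history h -> (htime h < T)%N ->
  [/\ forall a, 0 <= u h a,
      forall a, a \notin admissible D h.2 -> u h a = 0
    & \sum_(a : A) u h a = 1] ].

Definition DH (T : nat) : set dpolicy := [set d | forall h : history X A,
  admissible_history h -> (htime h < T)%N -> d h \in admissible D h.2].

Definition DM (T : nat) : set mpolicy := [set m | forall (t : nat) (x : X),
  (t < T)%N -> m t x \in admissible D x].

Definition randomized (d : dpolicy) : rpolicy := fun h a => (a == d h)%:R.

Definition of_markov (m : mpolicy) : dpolicy := fun h => m (htime h) h.2.

Definition step (u : rpolicy) (h : history X A) : wlist R (history X A) :=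
  [seq (u h a * q.1, (rcons h.1 (h.2, a), q.2))
     | a <- enum A, q <- kernel D h.2 a].

(* The law of the history (x_0, a_0, .., a_(t-1), x_t) under u. *)
Fixpoint law (u : rpolicy) (x0 : X) (t : nat) : wlist R (history X A) :=
  if t is t'.+1 then
    [seq (w.1 * v.1, v.2) | w <- law u x0 t', v <- step u w.2]
  else [:: (1, ([::], x0))].

End Policies.

(* trans and reward are total functions, but only their values at admissible
   state-action pairs are meaningful. *)
Record mdp (R : realType) (S A : finType) := Mdp {
  actions : S -> {set A};
  trans : S -> A -> S -> R;
  reward : S -> A -> R;
  actions_neq0 : forall s, actions s != finset.set0;
  actions_cover : (\bigcup_(s : S) actions s)%SET = [set: A]%SET;
  trans_ge0 : forall s a, a \in actions s -> forall s', 0 <= trans s a s';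
  trans_sum1 : forall s a, a \in actions s -> \sum_(s' : S) trans s a s' = 1
}.

Definition is_min (R : realType) (L : set R) (m : R) : Prop :=
  L m /\ lbound L m.

Definition is_max (R : realType) (L : set R) (m : R) : Prop :=
  L m /\ ubound L m.

(* Meant for L finite and nonempty, so that both extrema below exist. *)
Definition left_predecessor (R : realType) (L : set R) (lam : R) : R :=
  if `[< exists2 m, is_min L m & m < lam >]
  then xget 0 [set y | is_max [set z | L z /\ z < lam] y]
  else lam - 1.

Section FiniteHorizonVaR.
Variables (R : realType) (S A : finType) (M : mdp R S A) (T : nat).

Definition base : dynamics R S A :=
  Dynamics (actions M) (fun s a => [seq (trans M s a s', s') | s' <- enum S]).

Definition augmented : dynamics R (S * R) A :=
  Dynamics (fun x => actions M x.1)
    (fun x a => [seq (trans M x.1 a s', (s', x.2 - reward M x.1 a))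
                   | s' <- enum S]).

Definition total_reward (k : seq (S * A)) : R :=
  \sum_(p <- k) reward M p.1 p.2.

Definition Lambda0 : set R :=
  [set total_reward k | k in
     [set k : seq (S * A) | size k = T /\ all (admissible_pair base) k]].

(* For 0 < alpha <= 1 and u in RH base T, the infimum is over a nonempty set
   that is bounded below, and the supremum in VaRstar is over a nonempty bounded
   set; the default values of inf and sup do not occur. *)
Definition VaR (alpha : R) (u : rpolicy R S A) (s0 : S) : R :=
  inf [set lam : R |
    alpha <= prob (law base u s0 T) (fun h => total_reward h.1 <= lam)].

Definition VaRstar (alpha : R) (s0 : S) : R :=
  sup [set VaR alpha u s0 | u in RH base T].

(* h.2.2 is the second component lambda_T of the final augmented state. *)
Definition V0 (u : rpolicy R (S * R) A) (s0 : S) (lam0 : R) : R :=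
  expect (law augmented u (s0, lam0) T) (fun h => (0 <= h.2.2)%R%:R).

Definition V0_DM (m : mpolicy (S * R) A) : S -> R -> R :=
  V0 (randomized R (of_markov m)).

Definition ustar (alpha : R) (m : mpolicy (S * R) A) : dpolicy S A := fun h =>
  m (htime h)
    (h.2, left_predecessor Lambda0 (VaRstar alpha (hstart h))
          - total_reward h.1).

End FiniteHorizonVaR.

(* Main.v *)
(* Backward recursion on (s, lambda) computes the least probability W(s_0, lambda)
   of {R <= lambda} over all policies, attained by a greedy Markov policy of the
   augmented process. Let m be the least level of Lambda_0 with
   W(s_0, m) >= alpha. Every policy has P(R <= m) >= W(s_0, m) >= alpha, hence
   VaR <= m. Conversely W(s_0, m_-) < alpha for the left predecessor m_- of m, so
   a policy minimizing P(R <= m_-) has P(R <= lambda) < alpha for all lambda < m,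
   since R takes its values in Lambda_0; its VaR is therefore m. *)
Require Import Defs.
From HB Require Import structures.
From mathcomp Require Import all_boot all_order all_algebra.
From mathcomp Require Import boolp classical_sets reals.
Set Implicit Arguments.
Unset Strict Implicit.
Unset Printing Implicit Defensive.
Import Order.TTheory GRing.Theory Num.Theory.
Local Open Scope classical_set_scope.
Local Open Scope ring_scope.

(** * Extrema of finite sets of reals and left predecessors *)

Lemma exists_is_min (R : realType) (s : seq R) (L : set R) :
  (forall y, L y -> y \in s) -> L !=set0 -> exists m, is_min L m.
Proof.
elim: s L => [|x s IHs] L sub [y Ly]; first by have := sub _ Ly.
(* The elements of [L] below the head [x] lie in the tail, and a minimum of these is a minimum of
   [L]. *)
have [[z [Lz zx]]|none] := pselect (exists z, L z /\ z < x).
  have [w []||m [[Lm mx] min_m]] := IHs [set w | L w /\ w < x].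
  - by move=> /sub; rewrite inE => /predU1P[->|//]; rewrite ltxx.
  - by exists z.
  exists m; split=> // w Lw; case: (ltP w x) => [wx|xw]; first exact: min_m.
  by rewrite (le_trans _ xw)// ltW.
have lb w : L w -> x <= w.
  by move=> Lw; rewrite leNgt; apply/negP => wx; apply: none; exists w.
have [Lx|nLx] := pselect (L x); first by exists x.
apply: IHs; last by exists y.
by move=> w Lw; have := sub _ Lw; rewrite inE => /predU1P[wx|//]; rewrite -wx in nLx.
Qed.

Lemma exists_is_max (R : realType) (s : seq R) (L : set R) :
  (forall y, L y -> y \in s) -> L !=set0 -> exists m, is_max L m.
Proof.
move=> sub [y Ly].
have [z|//=|m [Lm min_m]] := @exists_is_min R (map -%R s) [set z | L (- z)].
- by move=> /= /sub; rewrite -{2}[z]opprK; apply: map_f.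
- by exists (- y); rewrite /= opprK.
- exists (- m); split=> // z Lz; rewrite lerNr; apply: min_m.
  by rewrite /= opprK.
Qed.

(** The default [lam - 1] occurs only when no element of [L] is below [lam], so it lies below all of
    [L]; in both cases nothing in [L] falls strictly between the predecessor and [lam]. *)
Lemma left_predecessorP (R : realType) (s : seq R) (L : set R) (lam : R) :
  (forall y, L y -> y \in s) -> L lam ->
  let p := left_predecessor L lam in
  [/\ p < lam, forall y, L y -> y < lam -> y <= p
    & L p \/ forall y, L y -> p < y].
Proof.
move=> sub Llam; rewrite /left_predecessor; case: asboolP => [[m [Lm _] mlam]|nomin].
  case: xgetP => [p _ [[Lp plam] max_p]|none].
    by split=> //; [move=> y Ly ylam; exact: max_p|left].
  have [y [] /sub//||p max_p] := @exists_is_max R s [set z | L z /\ z < lam].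
    by exists m.
  by case: (none p).
have lb y : L y -> lam <= y.
  move=> Ly; rewrite leNgt; apply/negP => ylam; apply: nomin.
  have [|m min_m] := exists_is_min sub; first by exists lam.
  by exists m => //; apply: le_lt_trans ylam; apply: min_m.2.
have plam : lam - 1 < lam by rewrite gtrBl.
split=> // [y /lb lamy|]; first by rewrite ltNge lamy.
by right=> y /lb; apply: lt_le_trans.
Qed.

Lemma inf_is_min (R : realType) (L : set R) (m : R) : is_min L m -> inf L = m.
Proof.
move=> [Lm lbm]; apply/le_anti/andP; split.
  by apply: ge_inf => //; exists m.
by apply: lb_le_inf => //; exists m.
Qed.

Lemma sup_is_max (R : realType) (L : set R) (m : R) : is_max L m -> sup L = m.
Proof.
move=> [Lm ubm]; apply/le_anti/andP; split.
  by apply: ge_sup => //; exists m.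
by apply: ub_le_sup => //; exists m.
Qed.

Lemma is_min_unique (R : realType) (L : set R) (m m' : R) :
  is_min L m -> is_min L m' -> m = m'.
Proof. by move=> /inf_is_min <- /inf_is_min <-. Qed.

(** * Expectations and policies for general dynamics *)

Lemma expect_law_succ (R : realType) (X : Type) (A : finType)
    (D : dynamics R X A) (u : rpolicy R X A) (x0 : X) (t : nat)
    (f : history X A -> R) :
  expect (law D u x0 t.+1) f
  = expect (law D u x0 t) (fun h => expect (step D u h) f).
Proof.
rewrite /expect /= big_allpairs_dep; apply: eq_bigr => w _.
by rewrite mulr_sumr; apply: eq_bigr => v _ /=; rewrite mulrA.
Qed.

Lemma randomized_RH (R : realType) (X : Type) (A : finType)
    (D : dynamics R X A) (T : nat) (d : dpolicy X A) :
  DH D T d -> RH D T (randomized R d).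
Proof.
move=> Dd h adm_h hT; split=> [a|a|]; rewrite /randomized ?ler0n//.
  by case: eqP => // ->; rewrite Dd.
by rewrite (bigD1 (d h))//= eqxx big1 ?addr0// => a /negPf->.
Qed.

Lemma of_markov_DH (R : realType) (X : Type) (A : finType)
    (D : dynamics R X A) (T : nat) (m : mpolicy X A) :
  DM D T m -> DH D T (of_markov m).
Proof. by move=> Dm h _; apply: Dm. Qed.

Lemma expect_step_randomized (R : realType) (X : Type) (A : finType)
    (D : dynamics R X A) (d : dpolicy X A) (h : history X A)
    (f : history X A -> R) :
  expect (step D (randomized R d) h) f
  = expect (kernel D h.2 (d h)) (fun x => f (rcons h.1 (h.2, d h), x)).
Proof.
rewrite /expect big_allpairs_dep big_enum (bigD1 (d h))//= [X in _ + X]big1 ?addr0.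
  by apply: eq_bigr => q _; rewrite /randomized eqxx mul1r.
move=> a /negPf ad; apply: big1 => q _ /=.
by rewrite /randomized ad !mul0r.
Qed.

(** * Expectations along the base process *)

Section Base.
Variables (R : realType) (S A : finType) (M : mdp R S A).
Implicit Types (u : rpolicy R S A) (h : history S A) (k : seq (S * A)).

Lemma total_reward_rcons k s a :
  total_reward M (rcons k (s, a)) = total_reward M k + reward M s a.
Proof. by rewrite /total_reward -cats1 big_cat big_seq1. Qed.

Lemma expect_step_base u h f :
  expect (step (base M) u h) f
  = \sum_a u h a * \sum_s trans M h.2 a s * f (rcons h.1 (h.2, a), s).
Proof.
rewrite /expect big_allpairs_dep big_enum; apply: eq_bigr => a _.
rewrite big_map big_enum mulr_sumr; apply: eq_bigr => s _ /=.
by rewrite mulrA.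
Qed.

(** Policies and [trans] are constrained only at admissible arguments, so integrands are compared
    only on histories that the law can produce. *)
Definition reachable s0 t h :=
  [/\ htime h = t, admissible_history (base M) h & hstart h = s0].

Lemma reachable_rcons s0 t h a s : a \in actions M h.2 ->
  reachable s0 t h -> reachable s0 t.+1 (rcons h.1 (h.2, a), s).
Proof.
case: h => k x /= ax [<- adm_h <-]; split.
- by rewrite /htime size_rcons.
- by rewrite /admissible_history all_rcons; apply/andP.
- by rewrite /hstart /=; case: k {adm_h}.
Qed.

Variable T : nat.

Lemma expect_law_le u s0 t f g : RH (base M) T u -> (t <= T)%N ->
  (forall h, reachable s0 t h -> f h <= g h) ->
  expect (law (base M) u s0 t) f <= expect (law (base M) u s0 t) g.
Proof.
move=> RHu; elim: t f g => [|t IHt] f g tT fg.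
  by rewrite /expect /= !big_seq1/= !mul1r; apply: fg.
rewrite !expect_law_succ; apply: IHt => [|h reach_h]; first exact: ltnW.
rewrite !expect_step_base; have [ht adm_h _] := reach_h.
have hT : (htime h < T)%N by rewrite ht.
have [u_ge0 u_adm _] := RHu h adm_h hT.
(* Inadmissible actions have policy weight 0, which removes transition weights of unknown sign. *)
apply: ler_sum => a _; have [aA|/u_adm->] := boolP (a \in actions M h.2); last first.
  by rewrite !mul0r.
apply: ler_wpM2l => //; apply: ler_sum => s _.
by apply: ler_wpM2l; [exact: trans_ge0|exact/fg/reachable_rcons].
Qed.

Lemma expect_law_eq u s0 t f g : RH (base M) T u -> (t <= T)%N ->
  (forall h, reachable s0 t h -> f h = g h) ->
  expect (law (base M) u s0 t) f = expect (law (base M) u s0 t) g.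
Proof.
move=> RHu tT fg.
by apply/le_anti/andP; split; apply: expect_law_le => // h /fg ->.
Qed.

Lemma expect_law_cst u s0 t c : RH (base M) T u -> (t <= T)%N ->
  expect (law (base M) u s0 t) (fun=> c) = c.
Proof.
move=> RHu; elim: t => [|t IHt] tT; first by rewrite /expect big_seq1 mul1r.
rewrite -[RHS](IHt (ltnW tT)) expect_law_succ.
apply: expect_law_eq (ltnW tT) _ => // h [ht adm_h _].
have hT : (htime h < T)%N by rewrite ht.
have [_ u_adm u1] := RHu h adm_h hT.
rewrite expect_step_base -[RHS]mul1r -u1 mulr_suml; apply: eq_bigr => a _.
have [aA|/u_adm->] := boolP (a \in actions M h.2); last by rewrite !mul0r.
by rewrite -mulr_suml trans_sum1// mul1r.
Qed.

(** Serves to compare [ustar], whose level depends on the initial state, with a policy of fixed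
    level. *)
Lemma eq_policy_expect_law u v s0 t f : RH (base M) T u -> (t <= T)%N ->
  (forall h, hstart h = s0 -> u h =1 v h) ->
  expect (law (base M) u s0 t) f = expect (law (base M) v s0 t) f.
Proof.
move=> RHu + uv; elim: t f => [//|t IHt] f tT.
rewrite !expect_law_succ -IHt 1?ltnW//.
apply: expect_law_eq (ltnW tT) _ => // h [_ _ hs0].
by rewrite !expect_step_base; apply: eq_bigr => a _; rewrite uv.
Qed.

(** By the tower property, the one-step inequality makes the expectation of [F] nondecreasing in
    time. *)
Lemma expect_law_submartingale u s0 (F : history S A -> R) : RH (base M) T u ->
  (forall h, admissible_history (base M) h -> (htime h < T)%N ->
     F h <= expect (step (base M) u h) F) ->
  F ([::], s0) <= expect (law (base M) u s0 T) F.
Proof.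
move=> RHu subF; suff: forall t, (t <= T)%N ->
    F ([::], s0) <= expect (law (base M) u s0 t) F by apply.
elim=> [|t IHt] tT; first by rewrite /expect big_seq1 mul1r.
apply: le_trans (IHt (ltnW tT)) _; rewrite expect_law_succ.
apply: expect_law_le (ltnW tT) _ => // h [ht adm_h _].
by apply: subF => //; rewrite ht.
Qed.

(** * Backward recursion and greedy policies *)

Definition qvalue (v : S -> R -> R) s lam a : R :=
  \sum_s' trans M s a s' * v s' (lam - reward M s a).

Definition some_action s : A := xchoose (set0Pn _ (actions_neq0 M s)).

Lemma some_actionP s : some_action s \in actions M s.
Proof. exact: xchooseP. Qed.

Definition greedy (v : S -> R -> R) s lam : A :=
  [arg min_(a < some_action s in actions M s) qvalue v s lam a]%O.

Lemma greedyP v s lam :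
  greedy v s lam \in actions M s /\
  forall a, a \in actions M s -> qvalue v s lam (greedy v s lam) <= qvalue v s lam a.
Proof.
by rewrite /greedy; case: arg_minP => //; apply: some_actionP.
Qed.

(** Bellman recursion of the augmented minimization problem; [n] counts the decision epochs left. *)
Fixpoint value n s lam : R :=
  if n is n'.+1 then qvalue (value n') s lam (greedy (value n') s lam)
  else (0 <= lam)%R%:R.

(** The value-to-go read along a base history: a submartingale under every policy, a martingale
    under the greedy one. At time [T] it is the indicator of a total at most [lam]. *)
Definition potential lam h : R :=
  value (T - htime h) h.2 (lam - total_reward M h.1).

Lemma potential_start lam s0 : potential lam ([::], s0) = value T s0 lam.
Proof. by rewrite /potential /htime /= subn0 /total_reward big_nil subr0. Qed.

Lemma expect_potential u s0 lam : RH (base M) T u ->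
  expect (law (base M) u s0 T) (potential lam)
  = prob (law (base M) u s0 T) (fun h => total_reward M h.1 <= lam).
Proof.
move=> RHu; apply: expect_law_eq RHu (leqnn T) _ => h [ht _ _].
by rewrite /potential ht subnn /= subr_ge0.
Qed.

Lemma potential_rcons lam h a s : (htime h < T)%N ->
  potential lam (rcons h.1 (h.2, a), s)
  = value (T - (htime h).+1) s (lam - total_reward M h.1 - reward M h.2 a).
Proof.
by move=> hT; rewrite /potential /htime /= size_rcons total_reward_rcons opprD addrA.
Qed.

(** An average over actions is at least the minimum taken by the recursion, so [potential lam] is a
    submartingale. *)
Lemma value_le_prob u s0 lam : RH (base M) T u ->
  value T s0 lam
  <= prob (law (base M) u s0 T) (fun h => total_reward M h.1 <= lam).
Proof.
move=> RHu; rewrite -expect_potential// -potential_start.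
apply: expect_law_submartingale => // h adm_h hT.
have [u_ge0 u_adm u1] := RHu h adm_h hT.
rewrite expect_step_base -[leLHS]mul1r -u1 mulr_suml; apply: ler_sum => a _.
have [aA|/u_adm->] := boolP (a \in actions M h.2); last by rewrite !mul0r.
(* Writing the remaining time as a successor unfolds one step of the recursion. *)
apply: ler_wpM2l => //; rewrite {1}/potential -(subnSK hT) /=.
apply: le_trans (proj2 (greedyP _ _ _) a aA) _.
by rewrite /qvalue ler_sum// => s _; rewrite potential_rcons.
Qed.

(** Once the action of epoch [t] is taken, [T - t.+1] epochs remain. *)
Definition greedy_policy : mpolicy (S * R) A := fun t x =>
  greedy (value (T - t.+1)) x.1 x.2.

Lemma greedy_policy_DM : DM (augmented M) T greedy_policy.
Proof. by move=> t x _; apply: (greedyP _ _ _).1. Qed.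

(** Runs [m] on base histories, recomputing the augmented level from the rewards collected; [ustar]
    has this shape, with the left predecessor as [lam]. *)
Definition tracking lam (m : mpolicy (S * R) A) : dpolicy S A := fun h =>
  m (htime h) (h.2, lam - total_reward M h.1).

Lemma tracking_DH lam m :
  DM (augmented M) T m -> DH (base M) T (tracking lam m).
Proof. by move=> Dm h _ hT; apply: (Dm _ (_, _)). Qed.

(** The greedy action attains the minimum at each step, so [potential lam] is a martingale. *)
Lemma prob_greedy s0 lam :
  prob (law (base M) (randomized R (tracking lam greedy_policy)) s0 T)
    (fun h => total_reward M h.1 <= lam) = value T s0 lam.
Proof.
have RHu := randomized_RH (tracking_DH lam greedy_policy_DM).
have mart h : (htime h < T)%N -> expect (step (base M)
    (randomized R (tracking lam greedy_policy)) h) (potential lam) = potential lam h.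
  move=> hT; rewrite expect_step_randomized /expect big_map big_enum /=.
  rewrite {2}/potential -(subnSK hT) /=; apply: eq_bigr => s _.
  by rewrite potential_rcons.
rewrite -expect_potential// -potential_start.
suff: forall t, (t <= T)%N -> expect (law (base M)
    (randomized R (tracking lam greedy_policy)) s0 t) (potential lam)
    = potential lam ([::], s0) by apply.
elim=> [|t IHt] tT; first by rewrite /expect big_seq1 mul1r.
rewrite -(IHt (ltnW tT)) expect_law_succ.
by apply: expect_law_eq (ltnW tT) _ => // h [ht _ _]; rewrite mart// ht.
Qed.

(** * Reduction of the augmented process to the base process *)

Fixpoint lift_pairs lam k : seq (S * R * A) :=
  if k is (s, a) :: k' then (s, lam, a) :: lift_pairs (lam - reward M s a) k'
  else [::].

(* lambda_t is determined by lambda_0 and the base history, so an augmented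
   policy started at (s_0, lambda_0) amounts to a base policy. *)
Definition lift_history lam h : history (S * R) A :=
  (lift_pairs lam h.1, (h.2, lam - total_reward M h.1)).

Lemma size_lift_pairs lam k : size (lift_pairs lam k) = size k.
Proof. by elim: k lam => //= -[s a] k IHk lam /=; rewrite IHk. Qed.

Lemma lift_pairs_rcons lam k s a :
  lift_pairs lam (rcons k (s, a))
  = rcons (lift_pairs lam k) (s, lam - total_reward M k, a).
Proof.
elim: k lam => [|[s1 a1] k IHk] lam /=; first by rewrite /total_reward big_nil subr0.
by rewrite IHk /total_reward big_cons opprD addrA.
Qed.

Lemma all_lift_pairs lam k :
  all (admissible_pair (augmented M)) (lift_pairs lam k)
  = all (admissible_pair (base M)) k.
Proof. by elim: k lam => //= -[s a] k IHk lam /=; rewrite IHk. Qed.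

Lemma lift_policy_RH (u : rpolicy R (S * R) A) lam :
  RH (augmented M) T u -> RH (base M) T (u \o lift_history lam).
Proof.
move=> RHu h adm_h hT; apply: (RHu (lift_history lam h)).
  by rewrite /admissible_history all_lift_pairs.
by rewrite /htime size_lift_pairs.
Qed.

(** The level moves deterministically, so each base transition lifts to one augmented transition of
    the same weight. *)
Lemma expect_law_augmented (u : rpolicy R (S * R) A) s0 lam t f :
  expect (law (augmented M) u (s0, lam) t) f
  = expect (law (base M) (u \o lift_history lam) s0 t) (f \o lift_history lam).
Proof.
elim: t f => [|t IHt] f.
  by rewrite /expect !big_seq1 /= /lift_history /total_reward /= big_nil subr0.
rewrite !expect_law_succ IHt; apply: eq_bigr => w _; congr (_ * _).
rewrite expect_step_base /= /expect big_allpairs_dep big_enum.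
apply: eq_bigr => a _; rewrite big_map big_enum mulr_sumr.
apply: eq_bigr => s _ /=; rewrite mulrA; congr (_ * f _).
by rewrite /lift_history /= lift_pairs_rcons total_reward_rcons opprD addrA.
Qed.

Lemma V0_base (u : rpolicy R (S * R) A) s0 lam :
  V0 M T u s0 lam = prob (law (base M) (u \o lift_history lam) s0 T)
    (fun h => total_reward M h.1 <= lam).
Proof.
rewrite /V0 expect_law_augmented; apply: eq_bigr => w _ /=.
by rewrite subr_ge0.
Qed.

Lemma V0_DM_base (m : mpolicy (S * R) A) s0 lam :
  V0_DM M T m s0 lam
  = prob (law (base M) (randomized R (tracking lam m)) s0 T)
    (fun h => total_reward M h.1 <= lam).
Proof.
rewrite /V0_DM V0_base; congr (prob (law _ _ _ _) _).
apply/funext => h; apply/funext => a.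
by rewrite /= /randomized /of_markov /tracking /htime /= size_lift_pairs.
Qed.

Lemma value_min_DM s0 lam :
  is_min [set V0_DM M T m s0 lam | m in DM (augmented M) T] (value T s0 lam).
Proof.
split=> [|_ [m Dm <-]].
  by exists greedy_policy; [exact: greedy_policy_DM|rewrite V0_DM_base prob_greedy].
rewrite V0_DM_base; apply/value_le_prob/randomized_RH; exact: tracking_DH.
Qed.

(** Randomization and memory cannot go below [value]: a lifted policy is a base policy, to which
    [value_le_prob] applies. *)
Lemma value_min_RH s0 lam :
  is_min [set V0 M T u s0 lam | u in RH (augmented M) T] (value T s0 lam).
Proof.
split=> [|_ [u RHu <-]]; last by rewrite V0_base; apply/value_le_prob/lift_policy_RH.
exists (randomized R (of_markov greedy_policy)).
  exact/randomized_RH/of_markov_DH/greedy_policy_DM.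
by rewrite -[LHS]/(V0_DM M T _ s0 lam) V0_DM_base prob_greedy.
Qed.

(** * Attainable totals and their probabilities *)

Definition Lambda0_enum : seq R :=
  [seq total_reward M (tval w) | w <- enum {: T.-tuple (S * A)}].

(** Inclusion suffices for the existence of extrema; the list ranges over inadmissible sequences
    too. *)
Lemma Lambda0_enumP y : Lambda0 M T y -> y \in Lambda0_enum.
Proof.
move=> [k [kT _] <-].
by apply/mapP; exists (tcast kT (in_tuple k)); rewrite ?mem_enum// val_tcast.
Qed.

Lemma Lambda0_neq0 (s0 : S) : Lambda0 M T !=set0.
Proof.
exists (total_reward M (nseq T (s0, some_action s0))), (nseq T (s0, some_action s0)) => //.
by rewrite /= size_nseq all_nseq /admissible_pair /= some_actionP orbT.
Qed.

Lemma reachable_Lambda0 s0 h : reachable s0 T h -> Lambda0 M T (total_reward M h.1).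
Proof. by move=> [hT adm_h _]; exists h.1. Qed.

Lemma prob_total_le u s0 lam lam' : RH (base M) T u ->
  (forall y, Lambda0 M T y -> y <= lam -> y <= lam') ->
  prob (law (base M) u s0 T) (fun h => total_reward M h.1 <= lam)
  <= prob (law (base M) u s0 T) (fun h => total_reward M h.1 <= lam').
Proof.
move=> RHu sub; apply: expect_law_le => // h /reachable_Lambda0 /sub.
by case: (_ <= lam); rewrite ?ler0n// => ->.
Qed.

Lemma prob_total_eq0 u s0 lam : RH (base M) T u ->
  (forall y, Lambda0 M T y -> lam < y) ->
  prob (law (base M) u s0 T) (fun h => total_reward M h.1 <= lam) = 0.
Proof.
move=> RHu lb; rewrite -[RHS](expect_law_cst s0 0 RHu (leqnn T)).
apply: expect_law_eq => // h /reachable_Lambda0 /lb.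
by rewrite ltNge => /negPf ->.
Qed.

Lemma prob_total_eq1 u s0 lam : RH (base M) T u -> ubound (Lambda0 M T) lam ->
  prob (law (base M) u s0 T) (fun h => total_reward M h.1 <= lam) = 1.
Proof.
move=> RHu ub; rewrite -[RHS](expect_law_cst s0 1 RHu (leqnn T)).
by apply: expect_law_eq => // h /reachable_Lambda0 /ub ->.
Qed.

(** * Value at risk as a quantile of the minimal probabilities *)

Variable alpha : R.
Hypotheses (alpha_gt0 : 0 < alpha) (alpha_le1 : alpha <= 1).

Lemma VaR_le u s0 lam : RH (base M) T u -> alpha <= value T s0 lam ->
  VaR M T alpha u s0 <= lam.
Proof.
move=> RHu alpha_lam; have [m [Lm lb_m]] := exists_is_min Lambda0_enumP (Lambda0_neq0 s0).
apply: ge_inf; last exact: le_trans alpha_lam (value_le_prob _ _ RHu).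
(* The infimum needs a lower bound: below the least total [m] the probability is 0, hence less than
   [alpha]. *)
exists m => l /= alpha_l; rewrite leNgt; apply/negP => lm.
move: alpha_l; rewrite prob_total_eq0 ?leNgt ?alpha_gt0// => y /lb_m.
exact: lt_le_trans.
Qed.

(* No attainable total lies strictly between the left predecessor and lam, so
   P(R <= l) < alpha for every l < lam. *)
Lemma VaR_ge u s0 lam : RH (base M) T u -> Lambda0 M T lam ->
  prob (law (base M) u s0 T)
    (fun h => total_reward M h.1 <= left_predecessor (Lambda0 M T) lam) < alpha ->
  alpha <= value T s0 lam -> lam <= VaR M T alpha u s0.
Proof.
move=> RHu Llam lt_alpha alpha_lam.
have [_ pred_max _] := left_predecessorP Lambda0_enumP Llam.
apply: lb_le_inf => [|l /= alpha_l].
  by exists lam; apply: le_trans alpha_lam (value_le_prob _ _ RHu).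
rewrite leNgt; apply/negP => l_lam.
suff : alpha < alpha by rewrite ltxx.
apply: le_lt_trans lt_alpha; apply: le_trans alpha_l _.
by apply: prob_total_le => // y Ly yl; apply: pred_max => //; apply: le_lt_trans l_lam.
Qed.

Definition quantile_levels s0 : set R :=
  [set lam | Lambda0 M T lam /\ alpha <= value T s0 lam].

Lemma quantile_levels_min s0 : exists m, is_min (quantile_levels s0) m.
Proof.
apply: (@exists_is_min _ Lambda0_enum) => [y [/Lambda0_enumP]//|].
(* At the greatest total the probability is 1, so this level qualifies because [alpha <= 1]. *)
have [m [Lm ub_m]] := exists_is_max Lambda0_enumP (Lambda0_neq0 s0).
exists m; split=> //; rewrite -prob_greedy prob_total_eq1//.
exact/randomized_RH/tracking_DH/greedy_policy_DM.
Qed.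

(** A predecessor in [Lambda0] is excluded by minimality of [m]; otherwise it lies below every total
    and the probability is 0. *)
Lemma value_left_predecessor_lt s0 m : is_min (quantile_levels s0) m ->
  value T s0 (left_predecessor (Lambda0 M T) m) < alpha.
Proof.
move=> [[Lm alpha_m] lb_m].
have [pm _ [Lp|below]] := left_predecessorP Lambda0_enumP Lm.
  rewrite ltNge; apply/negP => alpha_p; have : m <= left_predecessor (Lambda0 M T) m.
    exact: lb_m.
  by rewrite leNgt pm.
rewrite -prob_greedy prob_total_eq0//.
exact/randomized_RH/tracking_DH/greedy_policy_DM.
Qed.

(** Optimality asks for minimal probability at the left predecessor, not at [m]: this keeps every
    level below [m] under [alpha], while [m] itself reaches [alpha] under any policy. *)
Lemma VaR_eq u s0 m : RH (base M) T u -> is_min (quantile_levels s0) m ->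
  prob (law (base M) u s0 T)
    (fun h => total_reward M h.1 <= left_predecessor (Lambda0 M T) m)
    = value T s0 (left_predecessor (Lambda0 M T) m) ->
  VaR M T alpha u s0 = m.
Proof.
move=> RHu min_m prob_u; have [[Lm alpha_m] _] := min_m.
apply/le_anti; rewrite VaR_le//= VaR_ge// prob_u.
exact: value_left_predecessor_lt.
Qed.

Lemma VaRstar_quantile s0 : is_min (quantile_levels s0) (VaRstar M T alpha s0).
Proof.
have [m min_m] := quantile_levels_min s0; suff -> : VaRstar M T alpha s0 = m by [].
set lam := left_predecessor (Lambda0 M T) m.
have RHu : RH (base M) T (randomized R (tracking lam greedy_policy)).
  exact/randomized_RH/tracking_DH/greedy_policy_DM.
apply: sup_is_max; split=> [|_ [u RHu' <-]].
  by exists (randomized R (tracking lam greedy_policy)) => //; apply: VaR_eq; rewrite ?prob_greedy.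
by apply: VaR_le => //; case: min_m => -[].
Qed.

Lemma ustar_DH m :
  DM (augmented M) T m -> DH (base M) T (ustar M T alpha m).
Proof. by move=> Dm h _ hT; apply: (Dm _ (_, _)). Qed.

Lemma VaR_ustar m s0 : DM (augmented M) T m ->
  (forall lam, V0_DM M T m s0 lam = value T s0 lam) ->
  VaR M T alpha (randomized R (ustar M T alpha m)) s0 = VaRstar M T alpha s0.
Proof.
move=> Dm opt_m; have RHu := randomized_RH (ustar_DH Dm).
apply: VaR_eq => //; first exact: VaRstar_quantile.
(* On histories from [s0], [ustar] is [tracking] at the left predecessor of [VaRstar] at [s0]. *)
rewrite -opt_m V0_DM_base; apply: eq_policy_expect_law RHu (leqnn T) _ => h hs0 a.
by rewrite /randomized /ustar hs0.
Qed.

End Base.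

Theorem theorem5 (R : realType) (S A : finType) (M : mdp R S A) (T : nat)
    (alpha : R) (hT : (1 <= T)%N) (halpha0 : 0 < alpha) (halpha1 : alpha <= 1) :
  (forall s0 : S,
     (forall lam0 : R, Lambda0 M T lam0 ->
        exists m : R,
          is_min [set V0_DM M T ut s0 lam0 | ut in DM (augmented M) T] m) /\
     is_min
       [set lam0 : R | Lambda0 M T lam0 /\
          exists2 m : R,
            is_min [set V0_DM M T ut s0 lam0 | ut in DM (augmented M) T] m
            & alpha <= m]
       (VaRstar M T alpha s0)) /\
  (forall utstar : mpolicy (S * R) A,
     DM (augmented M) T utstar ->
     (forall (s0 : S) (lam0 : R),
        V0_DM M T utstar s0 lam0
        = inf [set V0 M T u s0 lam0 | u in RH (augmented M) T]) ->
     DH (base M) T (ustar M T alpha utstar) /\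
     (forall s0 : S,
        VaR M T alpha (randomized R (ustar M T alpha utstar)) s0
        = VaRstar M T alpha s0)).
Proof.
split=> [s0|m Dm opt_m].
  split=> [lam _|]; first by exists (value M T s0 lam); apply: value_min_DM.
  have [[Lm alpha_m] lb_m] := VaRstar_quantile M T halpha0 halpha1 s0.
  split=> [|lam [Llam [v min_v alpha_v]]].
    by split=> //; exists (value M T s0 (VaRstar M T alpha s0)) => //; apply: value_min_DM.
  apply: lb_m; split=> //.
  by rewrite (is_min_unique (value_min_DM _ _ _ _) min_v).
split=> [|s0]; first exact: ustar_DH.
(* The infimum over [RH] is attained and equals [value], so [m] satisfies the optimality condition
   of [VaR_ustar]. *)
apply: VaR_ustar => // lam; rewrite opt_m; apply: inf_is_min; exact: value_min_RH.
Qed.
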